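(* Let $n\geq 3$ and let $q$ be a prime power. Let $k\geq 0$. Then $\Delta_k^{+}(\mathrm{Fl}_{n,q})$ is a $|\mathrm{Fl}_{n,q}(k)|\times|\mathrm{Fl}_{n,q}(k)|$ matrix with entries $$\Delta_k^{+}(\mathrm{Fl}_{n,q})_{\sigma,\tau}=\begin{cases} n-k-2 & \text{if } \sigma=\tau,\\ (-1)^{\epsilon(\sigma,\tau)+1}\binom{r(\sigma\cup\tau,\sigma)}{t(\sigma\cup\tau,\sigma)}_q^{-1} & \text{if } |\sigma\cap \tau|=k,\ \sigma\cup\tau\in\mathrm{Fl}_{n,q},\\ 0 & \text{otherwise,}\end{cases}$$ for all $\sigma,\tau\in \mathrm{Fl}_{n,q}(k)$.
   Context: A linear subspace of $\mathbb{F}_q^n$ is non-trivial if it is neither $\{0\}$ nor $\mathbb{F}_q^n$. A flag is a family of nested non-trivial subspaces $V_1\subsetneq\cdots\subsetneq V_m$; a complete flag is one of length $n-1$. $\mathrm{Fl}_{n,q}$ is the simplicial complex whose vertices are the non-trivial subspaces of $\mathbb{F}_q^n$ and whose simplices are the families of subspaces forming a flag; $\mathrm{Fl}_{n,q}(k)$ is its set of $k$-dimensional simplices (flags with $k+1$ members). For a simplex $\sigma$, $w(\sigma)$ is the number of complete flags containing $\sigma$. $C^k(\mathrm{Fl}_{n,q})$ is the space of real $k$-cochains: skew-symmetric real functions on ordered $k$-simplices. The coboundary operator is $d_k\phi([v_0,\ldots,v_{k+1}])=\sum_{i=0}^{k+1}(-1)^i\phi([v_0,\ldots,v_{i-1},v_{i+1},\ldots,v_{k+1}])$.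 $C^k$ carries the inner product $\langle\phi,\psi\rangle=\sum_{\sigma\in \mathrm{Fl}_{n,q}(k)}w(\sigma)\phi(\sigma)\psi(\sigma)$; $d_k^*$ is the adjoint of $d_k$, and $\Delta_k^+(\mathrm{Fl}_{n,q})=d_k^*d_k$. Each simplex $\{V_1\subsetneq\cdots\subsetneq V_{k+1}\}$ is ordered by increasing dimension, and $\Delta_k^+$ is identified with its matrix in the standard basis $\{1_\sigma\}_{\sigma\in\mathrm{Fl}_{n,q}(k)}$, where $1_\sigma$ is the $k$-cochain that takes value $1$ on $\sigma$ with this order and $0$ on ordered simplices whose underlying set is not $\sigma$; the $(\sigma,\tau)$ entry is in row $1_\sigma$, column $1_\tau$. If $\sigma,\tau\in\mathrm{Fl}_{n,q}(k)$ satisfy $|\sigma\cap\tau|=k$ and $\sigma\cup\tau\in\mathrm{Fl}_{n,q}$, let $U$ be the unique element of $\sigma\setminus\tau$ and $V$ the unique element of $\tau\setminus\sigma$; $\epsilon(\sigma,\tau)$ is the number of elements of $\sigma\cap\tau$ lying between $U$ and $V$ (with respect to inclusion). For a flag $\rho=\{V_1\subsetneq\cdots\subsetneq V_m\}$ and $\eta=\rho\setminus\{V_i\}$, with $V_0=\{0\}$, $V_{m+1}=\mathbb{F}_q^n$, set $r(\rho,\eta)=\dim V_{i+1}-\dim V_{i-1}$ and $t(\rho,\eta)=\dim V_i-\dim V_{i-1}$. $\binom{a}{b}_q$ is the number of $b$-dimensional subspaces of $\mathbb{F}_q^a$. *)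

(* Defs.v *)
From HB Require Import structures.
From mathcomp Require Import all_boot all_order all_fingroup all_algebra.
From mathcomp Require classical_sets.

Set Implicit Arguments.
Unset Strict Implicit.
Unset Printing Implicit Defensive.

Import Order.TTheory GRing.Theory Num.Theory.
Import VectorInternalTheory.

Local Open Scope ring_scope.

HB.instance Definition _ (F : finFieldType) (vT : vectType F) :=
  [Countable of {vspace vT} by <:].
HB.instance Definition _ (F : finFieldType) (vT : vectType F) :=
  [Finite of {vspace vT} by <:].

Definition gbinom (F : finFieldType) (a b : nat) : nat :=
  #|[set U : {vspace 'rV[F]_a} | \dim U == b]|.

Section Flags.

Variables (F : finFieldType) (n : nat).

Definition subspace : Type := {vspace 'rV[F]_n}.
HB.instance Definition _ := Finite.on subspace.

Implicit Types (U V W : subspace) (sigma tau rho eta : {set subspace}).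

Definition nontrivial V : bool := (V != 0%VS) && (V != fullv).

Definition is_flag sigma : bool :=
  [forall V in sigma, nontrivial V] &&
  [forall U in sigma, forall V in sigma, (U <= V)%VS || (V <= U)%VS].

Definition complete_flag sigma : bool := is_flag sigma && (#|sigma| == n.-1).

Definition weight sigma : nat :=
  #|[set rho | complete_flag rho & sigma \subset rho]|.

Definition chain sigma : seq subspace :=
  sort (fun U V => \dim U <= \dim V)%N (enum sigma).

(* For a flag sigma = {V_1 < ... < V_m}, the subspace V_i for 0 <= i <= m + 1,
   where V_0 = 0 and V_(m+1) is the whole space. *)
Definition flag_nth sigma (i : nat) : subspace :=
  nth fullv (0%VS :: rcons (chain sigma) fullv) i.

(* The unique element of sigma, when sigma is a singleton. *)
Definition the_elt sigma : subspace := odflt 0%VS [pick V in sigma].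

(* For eta = rho minus {V_i}, the index i (counted from 1). *)
Definition removed_index rho eta : nat :=
  (index (the_elt (rho :\: eta)) (chain rho)).+1.

Definition r_flag rho eta : nat :=
  let i := removed_index rho eta in
  (\dim (flag_nth rho i.+1) - \dim (flag_nth rho i.-1))%N.

Definition t_flag rho eta : nat :=
  let i := removed_index rho eta in
  (\dim (flag_nth rho i) - \dim (flag_nth rho i.-1))%N.

Definition between U V W : bool :=
  (U <= W <= V)%VS || (V <= W <= U)%VS.

Definition epsilon sigma tau : nat :=
  #|[set W in sigma :&: tau |
      between (the_elt (sigma :\: tau)) (the_elt (tau :\: sigma)) W]|.

Definition is_simplex (k : nat) sigma : bool :=
  is_flag sigma && (#|sigma| == k.+1).

Definition simplex (k : nat) : Type := {sigma | is_simplex k sigma}.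
HB.instance Definition _ k := SubFinite.on (simplex k).

Definition is_osimplex (k : nat) (s : k.+1.-tuple subspace) : bool :=
  uniq s && is_flag [set V in s].

Definition osimplex (k : nat) : Type := {s | @is_osimplex k s}.
HB.instance Definition _ k := SubFinite.on (osimplex k).

Definition vertex k (s : osimplex k) (i : 'I_k.+1) : subspace :=
  tnth (val s) i.

Definition underlying k (s : osimplex k) : {set subspace} := [set V in val s].

Lemma is_flagS sigma tau : sigma \subset tau -> is_flag tau -> is_flag sigma.
Proof.
move=> /subsetP st /andP[/forall_inP nt /forall_inP ch].
apply/andP; split; first by apply/forall_inP => V /st; exact: nt.
apply/forall_inP => U /st Ut; apply/forall_inP => V /st.
by have /forall_inP := ch U Ut; apply.
Qed.

Lemma sub_osimplex_proof k l (s : osimplex k) (f : 'I_l.+1 -> 'I_k.+1) :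
  injective f -> is_osimplex [tuple vertex s (f i) | i < l.+1].
Proof.
have /andP[us fs] := valP s => fI; apply/andP; split.
  rewrite map_inj_uniq ?enum_uniq // => i j; rewrite /vertex /=.
  by move/(tuple_uniqP _ us)/fI.
apply: is_flagS fs; apply/subsetP => V; rewrite !inE => /mapP[i _ ->].
exact: mem_tnth.
Qed.

Definition sub_osimplex k l (s : osimplex k) (f : 'I_l.+1 -> 'I_k.+1)
    (fI : injective f) : osimplex l :=
  exist (fun s => is_true (is_osimplex s)) _ (sub_osimplex_proof s fI).

Definition face k (s : osimplex k.+1) (i : 'I_k.+2) : osimplex k :=
  sub_osimplex s (@lift_inj k.+2 i).

Definition perm_osimplex k (s : osimplex k) (p : 'S_k.+1) : osimplex k :=
  sub_osimplex s (@perm_inj _ p).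

Lemma osimplexP k (s t : osimplex k) :
  (forall i, vertex s i = vertex t i) -> s = t.
Proof. by move=> st; apply/val_inj/eq_from_tnth. Qed.

Lemma vertex_sub k l (s : osimplex k) (f : 'I_l.+1 -> 'I_k.+1)
  (fI : injective f) i : vertex (sub_osimplex s fI) i = vertex s (f i).
Proof. by rewrite /vertex tnth_mktuple. Qed.

Lemma perm_osimplexM k (s : osimplex k) (p p' : 'S_k.+1) :
  perm_osimplex (perm_osimplex s p) p' = perm_osimplex s (p' * p)%g.
Proof. by apply: osimplexP => i; rewrite !vertex_sub permM. Qed.

Lemma perm_osimplex1 k (s : osimplex k) : perm_osimplex s 1%g = s.
Proof. by apply: osimplexP => i; rewrite vertex_sub perm1. Qed.

Lemma perm_osimplex_inj k (s : osimplex k) : injective (perm_osimplex s).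
Proof.
move=> p p' e; apply/permP => i; have /andP[us _] := valP s; apply: (tuple_uniqP _ us).
by have := congr1 (fun t => vertex t i) e; rewrite !vertex_sub.
Qed.

Lemma underlying_perm k (s : osimplex k) (p : 'S_k.+1) :
  underlying (perm_osimplex s p) = underlying s.
Proof.
apply/eqP; rewrite eqEsubset; apply/andP; split; apply/subsetP => V.
  by rewrite !inE => /mapP[i _ ->]; exact: mem_tnth.
rewrite !inE => /tnthP[i ->]; apply/mapP; exists ((p^-1)%g i).
  by rewrite mem_enum.
by rewrite /vertex permKV.
Qed.

Lemma perm_osimplex_eqV k (s t : osimplex k) (p : 'S_k.+1) :
  (perm_osimplex s p == t) = (s == perm_osimplex t p^-1)%g.
Proof.
by apply/eqP/eqP => [<-|->]; rewrite perm_osimplexM ?mulVg ?mulgV perm_osimplex1.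
Qed.

Lemma face_perm k (s : osimplex k.+1) (p : 'S_k.+2) (i : 'I_k.+2) :
  exists2 p' : 'S_k.+1, p = odd i (+) odd (p i) (+) p' :> bool &
    face (perm_osimplex s p) i = perm_osimplex (face s (p i)) p'.
Proof.
have fP j : exists j', p (lift i j) == lift (p i) j'.
  have [j' ->|/perm_inj/eqP] := unliftP (p i) (p (lift i j)); first by exists j'.
  by rewrite eq_sym (negPf (neq_lift _ _)).
pose f j := xchoose (fP j).
have fE j : p (lift i j) = lift (p i) (f j) by apply/eqP/(xchooseP (fP j)).
have fI : injective f.
  by move=> j j' e; apply: (@lift_inj _ i); apply: (@perm_inj _ p); rewrite !fE e.
exists (perm fI).
  rewrite -odd_lift_perm; congr odd_perm; apply/permP => j.
  case: (unliftP i j) => [j'|] ->; last by rewrite lift_perm_id.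
  by rewrite lift_perm_lift permE fE.
by apply: osimplexP => j; rewrite !vertex_sub permE fE.
Qed.

Lemma orient_proof k (sigma : simplex k) :
  size (chain (val sigma)) == k.+1.
Proof. by rewrite size_sort -cardE; case/andP: (valP sigma). Qed.

Lemma orient_osimplex_proof k (sigma : simplex k) :
  is_osimplex (Tuple (orient_proof sigma)).
Proof.
rewrite /is_osimplex sort_uniq enum_uniq /=.
suff -> : [set V in Tuple (orient_proof sigma)] = val sigma.
  by case/andP: (valP sigma).
by apply/setP => V; rewrite !inE mem_sort mem_enum.
Qed.

Definition orient k (sigma : simplex k) : osimplex k :=
  exist (fun s => is_true (is_osimplex s)) _ (orient_osimplex_proof sigma).

Lemma underlying_orient k (sigma : simplex k) :
  underlying (orient sigma) = val sigma.
Proof. by apply/setP => V; rewrite !inE /= mem_sort mem_enum. Qed.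

End Flags.

Section Cochains.

Variables (R : realFieldType) (F : finFieldType) (n : nat).

Local Notation osimplex := (osimplex F n).
Local Notation simplex := (simplex F n).

Definition skew_defect k (phi : {ffun osimplex k -> R^o}) :
    {ffun osimplex k * 'S_k.+1 -> R^o} :=
  [ffun x => phi (perm_osimplex x.1 x.2) - (-1) ^+ x.2 * phi x.1].

Lemma skew_defect_linear k : linear (@skew_defect k).
Proof.
move=> a f g; apply/ffunP => x; rewrite !ffunE /GRing.scale /= mulrBr.
by rewrite mulrDr !mulrA [_ * a]mulrC opprD addrACA.
Qed.

HB.instance Definition _ k :=
  GRing.isLinear.Build _ _ _ _ (@skew_defect k) (@skew_defect_linear k).

(* The subspace of skew-symmetric functions; see skewP. *)
Definition skew k : {vspace {ffun osimplex k -> R^o}} :=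
  lker (linfun (@skew_defect k)).

Lemma skewP k (phi : {ffun osimplex k -> R^o}) :
  reflect (forall s (p : 'S_k.+1),
             phi (perm_osimplex s p) = (-1) ^+ p * phi s)
          (phi \in skew k).
Proof.
rewrite memv_ker lfunE /=; apply: (iffP eqP) => [h s p|h].
  by have /ffunP/(_ (s, p)) := h; rewrite !ffunE /= => /eqP; rewrite subr_eq0 => /eqP.
by apply/ffunP => x; rewrite !ffunE h subrr.
Qed.

Definition cochain k : vectType R := subvs_of (skew k).

Definition ev k (phi : cochain k) (s : osimplex k) : R :=
  (vsval phi : {ffun osimplex k -> R^o}) s.

Definition coboundary_fun k (phi : cochain k) :
    {ffun osimplex k.+1 -> R^o} :=
  [ffun s => \sum_(i < k.+2) (-1) ^+ i * ev phi (face s i)].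

Lemma coboundary_fun_skew k (phi : cochain k) :
  coboundary_fun phi \in skew k.+1.
Proof.
apply/skewP => s p; rewrite !ffunE mulr_sumr.
rewrite [RHS](reindex_inj (@perm_inj _ p)) /=; apply: eq_bigr => i _.
have [p' pE ->] := face_perm s p i.
rewrite /ev; have /skewP-> := subvsP phi; rewrite !mulrA; congr (_ * _).
rewrite -signr_odd -[in RHS](signr_odd _ (p i)) pE -!signr_addb.
by congr (_ ^+ _); case: (odd i); case: (odd (p i)); case: (odd_perm p').
Qed.

Definition coboundary k (phi : cochain k) : cochain k.+1 :=
  Subvs (coboundary_fun_skew phi).

Lemma coboundary_linear k : linear (@coboundary k).
Proof.
move=> a f g; apply/val_inj/ffunP => s; rewrite !ffunE /GRing.scale /=.
rewrite mulr_sumr -big_split; apply: eq_bigr => i _ /=.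
by rewrite /ev linearP !ffunE /GRing.scale /= mulrDr mulrCA.
Qed.

HB.instance Definition _ k :=
  GRing.isLinear.Build _ _ _ _ (@coboundary k) (@coboundary_linear k).

Definition d k : 'Hom(cochain k, cochain k.+1) := linfun (@coboundary k).

Definition inner k (phi psi : cochain k) : R :=
  \sum_(sigma : simplex k)
    (weight (val sigma))%:R * ev phi (orient sigma) * ev psi (orient sigma).

Definition is_adjoint k l (f : 'Hom(cochain k, cochain l))
    (g : 'Hom(cochain l, cochain k)) : Prop :=
  forall phi psi, inner (f phi) psi = inner phi (g psi).

(* The adjoint is unique because the weights of simplices are positive. *)
Definition adjoint k l (f : 'Hom(cochain k, cochain l)) :
    'Hom(cochain l, cochain k) :=
  classical_sets.xget 0 (is_adjoint f).

Definition upper_laplacian k : 'End(cochain k) := (adjoint (d k) \o d k)%VF.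

(* The sum has at most one nonzero term, because a permutation p with
   s = perm_osimplex (orient sigma) p is unique if it exists. *)
Definition indicator_fun k (sigma : simplex k) : {ffun osimplex k -> R^o} :=
  [ffun s => \sum_(p : 'S_k.+1 | perm_osimplex (orient sigma) p == s)
               (-1) ^+ p].

Lemma indicator_fun_skew k (sigma : simplex k) :
  indicator_fun sigma \in skew k.
Proof.
apply/skewP => s p; rewrite !ffunE mulr_sumr.
rewrite (reindex_inj (mulgI p)) /=; apply: eq_big => p'.
  rewrite -perm_osimplexM perm_osimplex_eqV perm_osimplexM mulVg.
  by rewrite perm_osimplex1.
by move=> _; rewrite odd_permM signr_addb.
Qed.

Definition indicator k (sigma : simplex k) : cochain k :=
  Subvs (indicator_fun_skew sigma).

Lemma ev_indicator_orient k (sigma : simplex k) :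
  ev (indicator sigma) (orient sigma) = 1.
Proof.
rewrite /ev ffunE (big_pred1 1%g) ?odd_perm1 // => p.
by rewrite -{2}[orient sigma]perm_osimplex1 (inj_eq (@perm_osimplex_inj _ _ _ _)).
Qed.

Lemma ev_indicator_neq k (sigma : simplex k) (s : osimplex k) :
  underlying s != val sigma -> ev (indicator sigma) s = 0.
Proof.
move=> ne; rewrite /ev ffunE big_pred0 // => p; apply: contraNF ne => /eqP<-.
by rewrite underlying_perm underlying_orient.
Qed.

Definition std_basis k : #|{: simplex k}|.-tuple (cochain k) :=
  [tuple indicator (enum_val i) | i < #|{: simplex k}|].

Definition matrix_in m (vT : vectType R) (X : m.-tuple vT) (f : 'End(vT)) :
    'M[R]_m :=
  \matrix_(i, j) coord X i (f X`_j).

Definition upper_laplacian_mx k : 'M[R]_#|{: simplex k}| :=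
  matrix_in (std_basis k) (upper_laplacian k).

End Cochains.

(* Main.v *)
Require Import Defs.
From HB Require Import structures.
From mathcomp Require Import all_boot all_order all_algebra all_fingroup.
From mathcomp Require Import zify.
From mathcomp Require classical_sets.
From mathcomp Require Import reals.

(** The indicator cochains are orthogonal, and the squared norm of 1_sigma is
w(sigma), which is positive because every flag extends to a complete one.
Therefore Delta = d^* d satisfies
  w(sigma) Delta(sigma, tau) = <d 1_sigma, d 1_tau>
                             = sum_rho w(rho) [rho : sigma] [rho : tau],
where rho runs over the (k+1)-simplices and [rho : sigma] is the incidence
number: it vanishes unless rho contains sigma, and then it is (-1)^i, with i the
position in rho of the member missing from sigma ([laplacian_entry],
[incidence_facet], [incidence_eq0]).

On the diagonal the squared signs disappear, and what remains is the sum of w(rho)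
over the cofacets rho of sigma. It counts pairs of a complete flag c containing
sigma and a member of c outside sigma, and there are (n - 1) - (k + 1) such
members for each c ([sum_weight_cofacets]).

Off the diagonal, a simplex rho that contains both sigma and tau must be their
union, and then sigma and tau share k members. In that case let V be the member
of rho missing from sigma, and A < V < B its neighbours in rho. Every complete
flag containing sigma has exactly one member of dimension dim V, and this member
lies between A and B; so w(sigma) is the sum of w(sigma + V') over all V' between
A and B with dim V' = dim V. These summands are all equal, because some linear
automorphism fixes every subspace below A or above B and takes V to V'
([transport_subspace], [weight_fill]); and their number is the q-binomial
coefficient, as seen from the quotient B / A ([card_interval]). Hence
w(rho) / w(sigma) is the inverse of the q-binomial coefficient
([weight_facet]). The product of the two signs has as exponent the sum of two
positions in rho, which has the parity of the number of members strictly between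
them, plus one ([sign_facets]). *)

Set Implicit Arguments.
Unset Strict Implicit.
Unset Printing Implicit Defensive.

Import Order.TTheory GRing.Theory Num.Theory.

Local Open Scope ring_scope.

(** * Subspaces between two given subspaces *)

Section Subspaces.

Variables (K : fieldType) (vT : vectType K).
Implicit Types (A B U V W : {vspace vT}).

Lemma eq_vspace_dim U V : (U <= V)%VS -> \dim U = \dim V -> U = V.
Proof. by move=> UV e; apply/eqP; rewrite eqEdim UV e leqnn. Qed.

Lemma basis_extend U W X :
  (U <= W)%VS -> basis_of U X -> basis_of W (X ++ vbasis (W :\: U)%VS).
Proof.
move=> UW bX; have E : (U + (W :\: U))%VS = W.
  by rewrite addvC addv_diff; apply/addv_idPl.
rewrite -{1}E; apply: cat_basis => //; last exact: vbasisP.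
by apply/directv_addP; rewrite capvC capv_diff.
Qed.

Lemma exists_intermediate A B d :
    (A <= B)%VS -> (\dim A <= d <= \dim B)%N ->
  exists U, [/\ (A <= U)%VS, (U <= B)%VS & \dim U = d].
Proof.
move=> AB /andP[Ad dB]; have dimB := dimv_cap_compl B A.
rewrite (capv_idPr AB) in dimB.
pose X := take (d - \dim A) (vbasis (B :\: A)%VS).
have fX : free X.
  have := basis_free (vbasisP (B :\: A)).
  by rewrite -(cat_take_drop (d - \dim A) (vbasis _)) => /catl_free.
have XD : (<<X>> <= B :\: A)%VS.
  rewrite -[X in (_ <= X)%VS](span_basis (vbasisP _)).
  by apply: sub_span => v /mem_take.
exists (A + <<X>>)%VS; split; first exact: addvSl.
  by rewrite subv_add AB (subv_trans XD) ?diffvSl.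
rewrite dimv_disjoint_sum; last first.
  by apply/eqP; rewrite -subv0 -(capv_diff B A) capvC capvS.
have /eqP -> : \dim <<X>>%VS == size X by [].
by rewrite size_takel ?subnKC // size_tuple leq_subLR dimB.
Qed.

Lemma lfun_fixes_span (g : 'End(vT)) X v :
  map g X = X -> v \in <<X>>%VS -> g v = v.
Proof.
move=> gX vX; have gE x : x \in X -> g x = x.
  by move: gX; rewrite -[X in _ = X]map_id => /eq_in_map; apply.
rewrite (coord_span (X := in_tuple X) vX) linear_sum; apply: eq_bigr => i _.
by rewrite linearZ /= gE // mem_nth.
Qed.

Lemma limg_fix (g : 'End(vT)) W : {in W, forall v, g v = v} -> (g @: W)%VS = W.
Proof.
move=> gW; apply/vspaceP => v; apply/memv_imgP/idP => [[w wW ->]|vW].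
  by rewrite gW.
by exists v; rewrite ?gW.
Qed.

(** The automorphism takes a basis of the space adapted to A <= V1 <= B to one
adapted to A <= V2 <= B. The two bases agree on the part spanning A and on the
part spanning a complement C of B. The subspaces below A are then fixed pointwise,
and one above B, being the sum of B and its intersection with C, is mapped to
itself. *)
Lemma transport_subspace A B V1 V2 :
    (A <= V1 <= B)%VS -> (A <= V2 <= B)%VS -> \dim V1 = \dim V2 ->
  exists g : 'End(vT),
    [/\ lker g == 0%VS, (g @: V1)%VS = V2,
        forall W, (W <= A)%VS -> (g @: W)%VS = W &
        forall W, (B <= W)%VS -> (g @: W)%VS = W].
Proof.
move=> /andP[AV1 V1B] /andP[AV2 V2B] dimV.
pose bV V := vbasis A ++ vbasis (V :\: A)%VS.
pose bB V := bV V ++ vbasis (B :\: V)%VS.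
pose bT V := bB V ++ vbasis (fullv :\: B)%VS.
have bVP V : (A <= V)%VS -> basis_of V (bV V).
  by move=> AV; apply: basis_extend => //; apply: vbasisP.
have bBP V : (A <= V <= B)%VS -> basis_of B (bB V).
  by move=> /andP[AV VB]; apply: basis_extend => //; apply: bVP.
have bTP V : (A <= V <= B)%VS -> basis_of fullv (bT V).
  by move=> AVB; apply: basis_extend; rewrite ?subvf //; apply: bBP.
have [h hP] := linear_of_free (bT V1) (bT V2).
have AVB1 : (A <= V1 <= B)%VS by rewrite AV1.
have AVB2 : (A <= V2 <= B)%VS by rewrite AV2.
have sizeP U X : basis_of U X -> size X = \dim U.
  by move=> bX; rewrite (size_basis (X := in_tuple X) bX).
have {hP} : map h (bT V1) = bT V2.
  apply: hP; first exact: basis_free (bTP _ AVB1).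
  by rewrite !(sizeP fullv) ?bTP.
have sizeV : size (bV V1) = size (bV V2) by rewrite (sizeP V1) ?(sizeP V2) ?bVP.
have sizeB : size (bB V1) = size (bB V2) by rewrite !(sizeP B) ?bBP.
have hE v : linfun h v = h v by rewrite lfunE.
(* Both bases have segments of equal lengths, so the equality splits. *)
rewrite -(eq_map hE) map_cat => /eqP.
rewrite eqseq_cat ?size_map // => /andP[/eqP gB /eqP gC].
have := gB; rewrite map_cat => /eqP.
rewrite eqseq_cat ?size_map // => /andP[/eqP gV _].
have := gV; rewrite map_cat => /eqP.
rewrite eqseq_cat ?size_map // => /andP[/eqP gA _].
set g := linfun h in gA gV gB gC *.
(* Here gA, gV, gB and gC say that g matches the initial segments of the two bases
   that span A, Vi and B, and their common final segment. *)
have gVE : (g @: V1)%VS = V2.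
  by rewrite -(span_basis (bVP _ AV1)) limg_span gV (span_basis (bVP _ AV2)).
have gBE : (g @: B)%VS = B.
  by rewrite -{1}(span_basis (bBP _ AVB1)) limg_span gB (span_basis (bBP _ AVB2)).
have gCE : {in (fullv :\: B)%VS, forall v, g v = v}.
  by move=> v; rewrite -(span_basis (vbasisP (fullv :\: B))); apply: lfun_fixes_span.
have gT : (g @: fullv)%VS = fullv.
  have <- : ((fullv :\: B) + B)%VS = fullv.
    by rewrite addv_diff; apply/addv_idPl/subvf.
  by rewrite limgD gBE limg_fix.
exists g; split => //.
- have := limg_ker_dim g fullv; rewrite gT capfv => /eqP.
  by rewrite -[X in _ == X]add0n eqn_add2r dimv_eq0.
- move=> W WA; apply: limg_fix => v /(subvP WA).
  by rewrite -(span_basis (vbasisP A)); apply: lfun_fixes_span.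
move=> W BW; have -> : W = (B + (fullv :\: B) :&: W)%VS.
  by rewrite vspace_modl // addvC addv_diff (addv_idPl (subvf _)) capfv.
rewrite limgD gBE limg_fix // => v; rewrite memv_cap => /andP[vC _].
exact: gCE.
Qed.

End Subspaces.

(** A complement D of A in B stands for the quotient B / A. It is isomorphic to
the coordinate space by some f, and U |-> A + f(U) is the correspondence between
subspaces of the quotient and subspaces of B containing A: intersecting with D
inverts it, by the modular law. *)
Lemma card_interval (F : finFieldType) (n : nat) (A B : {vspace 'rV[F]_n}) d :
    (A <= B)%VS -> (\dim A <= d)%N ->
  #|[set U : {vspace 'rV[F]_n} | (A <= U <= B)%VS & \dim U == d]| =
  gbinom F (\dim B - \dim A) (d - \dim A).
Proof.
move=> AB Ad; have dimB := dimv_cap_compl B A; rewrite (capv_idPr AB) in dimB.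
set D := (B :\: A)%VS in dimB.
have AD0 : (A :&: D = 0)%VS by rewrite capvC capv_diff.
have ADB : (A + D = B)%VS by rewrite addvC addv_diff; apply/addv_idPl.
set r := (\dim B - \dim A)%N; have rE : r = \dim D by rewrite /r -dimB addKn.
have [h hP] := linear_of_free (vbasis {:'rV[F]_r}) (vbasis D).
have {hP} hD : map h (vbasis fullv) = vbasis D.
  apply: hP; first exact: basis_free (vbasisP _).
  by rewrite !size_tuple -rE dimvf /dim /= mul1n.
pose f := linfun h; have fE v : f v = h v by rewrite lfunE.
have fD : (f @: fullv = D)%VS.
  rewrite -(span_basis (vbasisP fullv)) limg_span (eq_map fE) hD.
  exact: span_basis (vbasisP _).
have kf : lker f == 0%VS.
  have := limg_ker_dim f fullv; rewrite fD capfv -rE => /eqP.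
  rewrite dimvf /dim /= mul1n -[X in _ == X]add0n eqn_add2r dimv_eq0 //.
have subD U : (f @: U <= D)%VS by rewrite -fD limgS ?subvf.
have capD U : ((A + f @: U) :&: D = f @: U)%VS.
  by rewrite addvC -vspace_modl ?subD // AD0 addv0.
have dimf U : \dim (f @: U) = \dim U.
  by apply: limg_dim_eq; rewrite (eqP kf) capv0.
have dimA U : \dim (A + f @: U) = (\dim A + \dim U)%N.
  rewrite dimv_disjoint_sum ?dimf //; apply/eqP; rewrite -subv0 -AD0.
  exact: capvS (subvv _) (subD U).
pose p U := (A + f @: U)%VS.
have pI : injective p.
  move=> U U' e; have : (f @: U = f @: U')%VS by rewrite -capD -/(p U) e capD.
  by move=> e'; apply/eqP; rewrite eqEsubv -!(limg_ker0 _ _ kf) e' subvv.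
rewrite /gbinom -(card_imset _ pI); congr #|pred_of_set _|.
apply/setP => U; rewrite inE; apply/andP/imsetP => [[/andP[AU UB] /eqP dU]|].
  have UE : U = p (f @^-1: (U :&: D))%VS.
    rewrite /p lpreimK ?fD ?capvSr // capvC vspace_modl // ADB capvC.
    exact/esym/capv_idPl.
  exists (f @^-1: (U :&: D))%VS => //.
  by rewrite inE -dU {2}UE dimA addKn.
case=> U'; rewrite inE => /eqP dU' ->; rewrite /p addvSl dimA dU' subnKC //.
by rewrite subv_add AB (subv_trans (subD _)) ?diffvSl.
Qed.

(** * Flags and the dimensions of their members *)

Section FlagTheory.

Variables (F : finFieldType) (n : nat).
Implicit Types (A B U V W : subspace F n) (s c : {set subspace F n}).

Lemma dim_fullv : \dim {:'rV[F]_n} = n.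
Proof. by rewrite dimvf /dim /= mul1n. Qed.

(** Adding the conventional ends V_0 and V_(m+1) lets the first and the last gap
of a flag be treated like the others. *)
Definition augment s : {set subspace F n} := 0%VS |: (fullv |: s).

Lemma sub_augment s V : V \in s -> V \in augment s.
Proof. by rewrite !inE => ->; rewrite !orbT. Qed.

Lemma augmentS s c : s \subset c -> augment s \subset augment c.
Proof. by move=> sc; rewrite !setUS. Qed.

Lemma augment_le s U V : is_flag s -> U \in augment s -> V \in augment s ->
  (U <= V)%VS = (\dim U <= \dim V)%N.
Proof.
move=> /andP[_ /forall_inP ch] Us Vs; apply/idP/idP => [|UV]; first exact: dimvS.
have /orP[//|VU] : (U <= V)%VS || (V <= U)%VS.
  move: Us Vs; rewrite !inE.
  case/orP => [/eqP->|/orP[/eqP->|Us]]; rewrite ?sub0v ?subvf ?orbT //.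
  case/orP => [/eqP->|/orP[/eqP->|Vs]]; rewrite ?sub0v ?subvf ?orbT //.
  exact: (forall_inP (ch U Us)).
by rewrite (eq_vspace_dim VU) //; apply/eqP; rewrite eqn_leq dimvS.
Qed.

Lemma flag_le s U V : is_flag s -> U \in s -> V \in s ->
  (U <= V)%VS = (\dim U <= \dim V)%N.
Proof. by move=> fs Us Vs; apply: (augment_le fs); apply: sub_augment. Qed.

Lemma flag_dim_inj s : is_flag s -> {in s &, injective (fun V => \dim V)}.
Proof.
move=> fs U V Us Vs e; apply: eq_vspace_dim => //.
by rewrite (flag_le fs) // e.
Qed.

Lemma flag_nontrivial s V : is_flag s -> V \in s -> nontrivial V.
Proof. by move=> /andP[/forall_inP nt _]; apply: nt. Qed.

Lemma nontrivial_dim V : nontrivial V = (0 < \dim V < n)%N.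
Proof.
rewrite /nontrivial -dimv_eq0 lt0n; congr (_ && _).
by rewrite eqEdim subvf dim_fullv -ltnNge.
Qed.

(** This makes complete flags tractable: having n - 1 members, they have
exactly one in each dimension from 1 to n - 1. *)
Lemma flag_dims s : is_flag s ->
  uniq [seq \dim V | V in s] /\ {subset [seq \dim V | V in s] <= iota 1 n.-1}.
Proof.
move=> fs; split.
  by rewrite map_inj_in_uniq ?enum_uniq // => U V; rewrite !mem_enum; apply: flag_dim_inj.
move=> _ /imageP[V Vs ->]; have := flag_nontrivial fs Vs.
by rewrite nontrivial_dim mem_iota; lia.
Qed.

Lemma complete_flag_dim c d : complete_flag c -> (0 < d < n)%N ->
  exists2 V, V \in c & \dim V = d.
Proof.
move=> /andP[fc /eqP cc] dn; have [u ss] := flag_dims fc.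
have sz : (size (iota 1 n.-1) <= size [seq \dim V | V in c])%N.
  by rewrite size_iota size_map -cardE cc.
have [_ sE] := uniq_min_size u ss sz.
have /imageP[V Vc ->] : d \in [seq \dim V | V in c] by rewrite sE mem_iota; lia.
by exists V.
Qed.

Lemma flag_insert s V : is_flag s -> nontrivial V ->
  {in s, forall W, (W <= V)%VS || (V <= W)%VS} -> is_flag (V |: s).
Proof.
move=> /andP[/forall_inP nt /forall_inP ch] ntV cmp; apply/andP; split.
  by apply/forall_inP => U /setU1P[->|/nt].
apply/forall_inP => U /setU1P[->|Us]; apply/forall_inP => W /setU1P[->|Ws].
- by rewrite subvv.
- by rewrite orbC cmp.
- by rewrite cmp.
exact: (forall_inP (ch U Us)).
Qed.

(** A maximal flag is complete. Otherwise it misses some dimension d, and a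
subspace of dimension d between its largest member below d and its smallest member
above d can be added to it. *)
Lemma complete_extension s : is_flag s ->
  exists2 c, complete_flag c & s \subset c.
Proof.
move=> fs; have [c /maxsetP[fc cmax] sc] := maxset_exists fs.
exists c => //; rewrite /complete_flag fc /=; apply: contraT => ncc.
have [u ss] := flag_dims fc.
have /allPn[d] : ~~ all (mem [seq \dim V | V in c]) (iota 1 n.-1).
  apply: contra ncc => /allP iss.
  move: (uniq_leq_size u ss) (uniq_leq_size (iota_uniq _ _) iss).
  by rewrite size_iota size_map -cardE => h1 h2; rewrite eqn_leq h1 h2.
rewrite mem_iota => dn /= dc; have {}dn : (0 < d < n)%N by lia.
have /andP[d0 dltn] := dn.
pose below V := (V \in augment c) && (\dim V < d)%N.
pose above V := (V \in augment c) && (d < \dim V)%N.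
have below0 : below 0%VS by rewrite /below !inE eqxx dimv0.
have aboveT : above fullv.
  by rewrite /above !inE eqxx orbT dim_fullv.
have [A /andP[Ac Ad] Amax] := arg_maxnP (fun V => \dim V : nat) below0.
have [B /andP[Bc Bd] Bmin] := arg_minnP (fun V => \dim V : nat) aboveT.
have AB : (A <= B)%VS by rewrite (augment_le fc) // ltnW // (ltn_trans Ad).
have [||U [AU UB dU]] := @exists_intermediate _ _ A B d _ _ => //.
  by rewrite (ltnW Ad) (ltnW Bd).
have fU : is_flag (U |: c).
  apply: flag_insert => //; first by rewrite nontrivial_dim dU.
  move=> W Wc; case: (ltngtP (\dim W) d) => [lt|gt|eq].
  - rewrite (subv_trans _ AU) // (augment_le fc) ?(sub_augment Wc) //; apply: Amax.
    by rewrite /below sub_augment.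
  - rewrite (subv_trans UB) ?orbT // (augment_le fc) ?(sub_augment Wc) //; apply: Bmin.
    by rewrite /above sub_augment.
  - by case/negP: dc; rewrite -eq; apply/image_f.
have Uc : U \in c by rewrite -(cmax _ fU (subsetUr _ _)) setU11.
by case/negP: dc; rewrite -dU; apply/image_f.
Qed.

Lemma flag_card_le s : is_flag s -> (#|s| <= n.-1)%N.
Proof.
by case/complete_extension => c /andP[_ /eqP <-]; apply: subset_leq_card.
Qed.

(** * Comparing the weights of a flag and of its facets *)

Lemma weight_gt0 s : is_flag s -> (0 < weight s)%N.
Proof.
by move=> /complete_extension[c cc sc]; apply/card_gt0P; exists c; rewrite inE cc.
Qed.

Lemma is_flag_limg (g : 'End('rV[F]_n)) s :
  lker g == 0%VS -> is_flag s -> is_flag [set (g @: W)%VS | W in s].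
Proof.
move=> kg fs; apply/andP; split.
  apply/forall_inP => _ /imsetP[W Ws ->].
  have := flag_nontrivial fs Ws; rewrite !nontrivial_dim limg_dim_eq //.
  by rewrite (eqP kg) capv0.
apply/forall_inP => _ /imsetP[U Us ->]; apply/forall_inP => _ /imsetP[V Vs ->].
by rewrite !limg_ker0 // !(flag_le fs) // leq_total.
Qed.

(** Filling a gap of a flag; its ends may be the conventional ones, so that A = 0
and B the whole space are included. *)
Section Gap.

Variables (s : {set subspace F n}) (A B : subspace F n).
Hypotheses (As : A \in augment s) (Bs : B \in augment s).
Hypothesis gap : {in s, forall W, (W <= A)%VS || (B <= W)%VS}.

(** An automorphism taking V1 to V2 and preserving the members of s maps the
complete flags containing V1 and s injectively to those containing V2 and s; the
opposite inequality holds by symmetry. *)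
Lemma weight_fill V1 V2 :
    (A <= V1 <= B)%VS -> (A <= V2 <= B)%VS -> \dim V1 = \dim V2 ->
  weight (V1 |: s) = weight (V2 |: s).
Proof.
wlog suff le : V1 V2 / (A <= V1 <= B)%VS -> (A <= V2 <= B)%VS ->
    \dim V1 = \dim V2 -> (weight (V1 |: s) <= weight (V2 |: s))%N.
  by move=> h1 h2 e; apply/eqP; rewrite eqn_leq !le.
move=> h1 h2 e; have [g [kg gV gA gB]] := transport_subspace h1 h2 e.
have gI : injective (lfun_img g).
  move=> U W E; apply/eqP.
  by rewrite eqEsubv -(limg_ker0 U W kg) -(limg_ker0 W U kg) E subvv.
have GI := imset_inj gI.
rewrite /weight -(card_imset _ GI); apply/subset_leq_card/subsetP => C /imsetP[c].
rewrite inE => /andP[/andP[fc cc] /subsetP sc] ->.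
rewrite inE /complete_flag is_flag_limg // card_imset // cc /=.
apply/subsetP => W /setU1P[->|Ws].
  by apply/imsetP; exists V1; rewrite ?gV // sc ?setU11.
apply/imsetP; exists W; first by rewrite sc ?setU1r.
by case/orP: (gap Ws) => [/gA|/gB].
Qed.

(** A complete flag containing s has exactly one member of dimension d, and
comparing dimensions places that member between A and B. *)
Lemma weight_sum_fill d : (0 < d < n)%N -> (\dim A <= d <= \dim B)%N ->
  weight s =
  (\sum_(V : subspace F n | (A <= V <= B)%VS && (\dim V == d)) weight (V |: s))%N.
Proof.
move=> dn /andP[Ad dB].
pose P (V : subspace F n) := (A <= V <= B)%VS && (\dim V == d).
transitivity
  (\sum_(V | P V) \sum_(c | complete_flag c && (V |: s \subset c)) 1)%N; last first.
  by apply: eq_bigr => V _; rewrite /weight -sum1_card; apply: eq_bigl => c; rewrite inE.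
rewrite (exchange_big_dep (fun c => complete_flag c && (s \subset c))) /=; last first.
  by move=> V c _ /andP[-> /subUsetP[_ ->]].
rewrite /weight -sum1_card; apply: eq_big => [c|c]; rewrite inE // => /andP[cc sc].
have [V Vc dV] := complete_flag_dim cc dn.
have /andP[fc _] := cc.
have Ac := subsetP (augmentS sc) _ As; have Bc := subsetP (augmentS sc) _ Bs.
rewrite (big_pred1 V) // => W; rewrite cc /= subUset sub1set sc andbT.
apply/andP/eqP => [[/andP[_ /eqP dW] Wc]|->].
  by apply: (flag_dim_inj fc); rewrite // dW.
have Va := sub_augment Vc.
by rewrite /P Vc (augment_le fc Ac Va) (augment_le fc Va Bc) dV Ad dB eqxx.
Qed.

Lemma weight_gap V : nontrivial V -> (A <= V <= B)%VS ->
  weight s = (gbinom F (\dim B - \dim A) (\dim V - \dim A) * weight (V |: s))%N.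
Proof.
move=> ntV AVB; have /andP[AV VB] := AVB.
rewrite (@weight_sum_fill (\dim V)) ?dimvS -?nontrivial_dim //.
rewrite (eq_bigr (fun=> weight (V |: s))); last first.
  by move=> W /andP[AWB /eqP dW]; apply: weight_fill.
rewrite sum_nat_const -card_interval ?dimvS ?(subv_trans AV) //.
by congr (_ * _)%N; apply: eq_card => W; rewrite !inE.
Qed.

End Gap.

Lemma chain_mem s V : (V \in chain s) = (V \in s).
Proof. by rewrite mem_sort mem_enum. Qed.

Lemma chain_uniq s : uniq (chain s).
Proof. by rewrite sort_uniq enum_uniq. Qed.

Lemma the_elt_set1 V : the_elt [set V] = V.
Proof.
rewrite /the_elt; case: pickP => [U /set1P //|/(_ V)]; by rewrite inE eqxx.
Qed.

(** The gap left by V is bounded by its neighbours in the list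
V_0, V_1, ..., V_(m+1), which r_flag and t_flag measure by their dimensions. *)
Lemma weight_facet s V : is_flag s -> V \in s ->
  weight (s :\ V) =
  (gbinom F (r_flag s (s :\ V)) (t_flag s (s :\ V)) * weight s)%N.
Proof.
move=> fs Vs; have ntV := flag_nontrivial fs Vs.
(* V_0 heads the list L, hence the member at position j of the chain is at position
   j + 1 of L. *)
pose L := 0%VS :: rcons (chain s) fullv.
pose i := (index V (chain s)).+1.
have ilt : (i <= size (chain s))%N by rewrite index_mem chain_mem.
have iE : removed_index s (s :\ V) = i.
  rewrite /removed_index; suff -> : s :\: (s :\ V) = [set V] by rewrite the_elt_set1.
  by apply/setP => W; rewrite !inE; case: eqVneq => [->|] //=; case: (W \in s).
have sL : size L = (size (chain s)).+2 by rewrite /= size_rcons.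
have nV : nth fullv L i = V.
  by rewrite /= nth_rcons -ltnS ltnS ilt nth_index // chain_mem.
have LP W : (W \in L) = (W \in augment s).
  by rewrite inE mem_rcons inE chain_mem !inE.
have uL : uniq L.
  rewrite /L cons_uniq rcons_uniq mem_rcons inE !chain_mem chain_uniq andbT.
  rewrite negb_or -andbA; apply/and3P; split.
  - apply: contraTneq ntV => /(congr1 (fun V => \dim V)).
    by rewrite dimv0 dim_fullv nontrivial_dim; lia.
  - by apply/negP => /(flag_nontrivial fs); rewrite nontrivial_dim dimv0.
  - by apply/negP => /(flag_nontrivial fs); rewrite nontrivial_dim dim_fullv ltnn andbF.
have soL : sorted leq [seq \dim W | W <- L].
  have soC : sorted (fun U W => \dim U <= \dim W)%N (chain s).
    by apply: sort_sorted => U W; apply: leq_total.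
  rewrite sorted_map /L /= path_sortedE; last by move=> ? ? ?; apply: leq_trans.
  apply/andP; split; first by apply/allP => W _ /=; rewrite dimv0.
  case: (chain s) soC => //= a l; rewrite rcons_path => -> /=.
  by rewrite dimvS ?subvf.
have dimL j l : (j <= l < size L)%N -> (\dim (nth fullv L j) <= \dim (nth fullv L l))%N.
  move=> /andP[jl lL]; have jL := leq_ltn_trans jl lL.
  rewrite -(nth_map _ 0%N (fun W : subspace F n => \dim W) jL).
  rewrite -(nth_map _ 0%N (fun W : subspace F n => \dim W) lL).
  by apply: (sorted_leq_nth leq_trans leqnn); rewrite // inE size_map.
have leL j l : (j <= l < size L)%N -> (nth fullv L j <= nth fullv L l)%VS.
  move=> jl; have /andP[jl' lL] := jl.
  by rewrite (augment_le fs) ?dimL // -LP mem_nth // (leq_ltn_trans jl' lL).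
pose A := nth fullv L i.-1; pose B := nth fullv L i.+1.
rewrite /r_flag /t_flag iE.
have -> : flag_nth s i = V by rewrite /flag_nth nV.
rewrite -/A -/B.
have augD j : (j < size L)%N -> j != i -> nth fullv L j \in augment (s :\ V).
  move=> jL ji; have : nth fullv L j \in augment s by rewrite -LP mem_nth.
  have ne : nth fullv L j != V.
    by rewrite -[X in _ != X]nV nth_uniq // sL ltnS ltnW.
  rewrite !inE => /orP[->//|/orP[->|->]]; rewrite ?orbT //.
  by rewrite ne !orbT.
rewrite (@weight_gap (s :\ V) A B _ _ _ V ntV) ?setD1K //.
- by apply: augD; move: ilt; rewrite ?sL /i /=; lia.
- by apply: augD; move: ilt; rewrite ?sL /i /=; lia.
- move=> W; rewrite !inE => /andP[WV Ws].
  have /(nthP fullv)[j jL nW] : W \in L by rewrite LP sub_augment.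
  have : j != i by apply: contraNneq WV => ij; rewrite -nW ij nV.
  rewrite -nW neq_ltn => /orP[lt|gt]; apply/orP; [left|right]; apply: leL.
    by rewrite sL; move: lt ilt; rewrite /i /=; lia.
  by rewrite gt.
have iL : (i.+1 < size L)%N by rewrite sL !ltnS.
rewrite -[X in (_ <= X <= _)%VS]nV /A /B !leL //; first by rewrite leqnSn.
by rewrite leq_pred ltnW.
Qed.

(** Both sides count the pairs of a complete flag c containing s and a member V of
c outside s, the pair being recorded on the left as c and V |: s. *)
Lemma sum_weight_cofacets s : is_flag s ->
  (\sum_(r : {set subspace F n} |
      [&& is_flag r, #|r| == #|s|.+1 & s \subset r]) weight r =
   (n.-1 - #|s|) * weight s)%N.
Proof.
move=> fs.
transitivity (\sum_(r : {set subspace F n} |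
       [&& is_flag r, #|r| == #|s|.+1 & s \subset r])
   \sum_(c | complete_flag c && (r \subset c)) 1)%N.
  by apply: eq_bigr => r _; rewrite /weight -sum1_card; apply: eq_bigl => c; rewrite inE.
rewrite (exchange_big_dep (fun c => complete_flag c && (s \subset c))) /=; last first.
  by move=> r c /and3P[_ _ sr] /andP[-> /(subset_trans sr)->].
rewrite mulnC /weight -sum_nat_const; apply: eq_big => [c|c /andP[cc sc]].
  by rewrite inE.
have /andP[fc /eqP nc] := cc.
have -> : (n.-1 - #|s|)%N = #|c :\: s| by rewrite cardsD (setIidPr sc) nc.
have I : {in c :\: s &, injective (fun V => V |: s)}.
  move=> U V; rewrite !inE => /andP[Us _] _ e.
  have : U \in V |: s by rewrite -e setU11.
  by rewrite !inE (negPf Us) orbF => /eqP.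
rewrite sum1_card -(card_in_imset I); apply: eq_card => r.
apply/idP/imsetP => [|[V]].
  move=> /andP[/and3P[_ /eqP cr sr] /andP[_ rc]].
  have /cards1P[V E] : #|r :\: s| == 1%N by rewrite cardsD (setIidPr sr) cr subSnn.
  have VE : V \in r :\: s by rewrite E set11.
  exists V; last first.
    by rewrite -E -[X in _ :|: X](setIidPr sr) setUC setID.
  by move: VE; rewrite !inE => /andP[-> /(subsetP rc)].
rewrite !inE => /andP[Vs Vc] ->.
have sub : V |: s \subset c by rewrite subUset sub1set Vc.
by rewrite unfold_in cc sub subsetUr cardsU1 Vs (is_flagS sub fc) eqxx.
Qed.

End FlagTheory.

(** * Positions in a flag and signs *)

Lemma index_sorted (T : eqType) (f : T -> nat) (l : seq T) x :
    sorted (relpre f ltn) l -> x \in l ->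
  index x l = count (fun y => f y < f x)%N l.
Proof.
elim: l => //= a l IH pal; rewrite inE.
have gta y : y \in l -> (f a < f y)%N.
  by move=> yl; apply: (allP (order_path_min _ pal)) => // ? ? ?; apply: ltn_trans.
case: (eqVneq x a) => [-> _|xa] /=.
  rewrite ltnn; apply/esym/eqP; rewrite add0n eqn0Ngt -has_count -all_predC.
  by apply/allP => y /gta /=; rewrite -leqNgt => /ltnW.
by move=> xl; rewrite gta // IH // (path_sorted pal).
Qed.

Lemma nth_rem (T : eqType) (x0 : T) (l : seq T) i j :
  uniq l -> (i < size l)%N ->
  nth x0 (rem (nth x0 l i) l) j = nth x0 l (bump i j).
Proof.
move=> ul il; rewrite remE index_uniq // nth_cat size_takel ?(ltnW il) //.
case: ltnP => ij; first by rewrite nth_take // /bump leqNgt ij.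
by rewrite nth_drop /bump ij; congr nth; lia.
Qed.

Section Orientation.

Variables (F : finFieldType) (n : nat).
Implicit Types (U V W : subspace F n) (s t r : {set subspace F n}).

Lemma chainD1 s V : chain (s :\ V) = rem V (chain s).
Proof.
rewrite rem_filter ?chain_uniq // filter_sort.
- congr sort; rewrite /enum_mem -filter_predI; apply: eq_filter => W /=.
  by rewrite !inE.
- by move=> U W; apply: leq_total.
by move=> U W X; apply: leq_trans.
Qed.

(** Positions become cardinals, which makes the parity of epsilon a matter of
counting. *)
Lemma index_chain s V : is_flag s -> V \in s ->
  index V (chain s) = #|[set W in s | \dim W < \dim V]%N|.
Proof.
move=> fs Vs; rewrite (@index_sorted _ (fun W => \dim W)) ?chain_mem //; last first.
  rewrite -sorted_map ltn_sorted_uniq_leq sorted_map; apply/andP; split.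
    rewrite map_inj_in_uniq ?chain_uniq // => U W; rewrite !chain_mem.
    exact: flag_dim_inj.
  by apply: sort_sorted => U W; apply: leq_total.
rewrite -size_filter cardE; apply/perm_size/uniq_perm.
- by rewrite filter_uniq ?chain_uniq.
- exact: enum_uniq.
by move=> W; rewrite mem_filter mem_enum inE chain_mem andbC.
Qed.


Lemma between_sym U V W : between U V W = between V U W.
Proof. by rewrite /between orbC. Qed.

(** The members of smaller dimension than V are those of smaller dimension than U,
then U itself, then those strictly between U and V. *)
Lemma card_between r U V : is_flag r -> U \in r -> V \in r ->
    (\dim U < \dim V)%N ->
  (index V (chain r) =
    index U (chain r) + #|[set W in r :\ V :\ U | between U V W]|.+1)%N.
Proof.
move=> fr Ur Vr UV; rewrite !index_chain //.
set X := [set W in _ | between _ _ _]; set Y := [set W in r | _ < \dim U]%N.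
have XU : U \notin X by rewrite !inE eqxx.
have dis : [disjoint Y & U |: X].
  rewrite disjoints_subset; apply/subsetP => W; rewrite !inE => /andP[Wr lt].
  case: eqVneq lt => [->|WU lt] /=; first by rewrite ltnn.
  rewrite /between Wr; case: eqVneq => //= WV.
  by rewrite !(flag_le fr) //; lia.
rewrite -[in RHS](add1n #|X|) -(_ : #|U |: X| = 1 + #|X|)%N; last by rewrite cardsU1 XU.
rewrite -cardsUI (disjoint_setI0 dis) cards0 addn0; apply: eq_card => W.
rewrite !inE; case Wr: (W \in r); last first.
  by rewrite !andbF !orbF /=; apply/esym/eqP => E; rewrite E Ur in Wr.
rewrite /= andbT /between !(flag_le fr) //.
case: (eqVneq W U) => [->|WU] /=; first by rewrite UV orbT.
case: (eqVneq W V) => [->|WV] /=; first by rewrite ltnn; lia.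
have dU : \dim W != \dim U by apply: contra_neq WU; apply: flag_dim_inj fr _ _ Wr Ur.
have dV : \dim W != \dim V by apply: contra_neq WV; apply: flag_dim_inj fr _ _ Wr Vr.
move: dU dV; lia.
Qed.

Lemma epsilon_facets r U V : U \in r -> V \in r -> U != V ->
  epsilon (r :\ V) (r :\ U) = #|[set W in r :\ V :\ U | between U V W]|.
Proof.
move=> Ur Vr UV; rewrite /epsilon.
have E A B : A \in r -> A != B -> r :\ B :\: (r :\ A) = [set A].
  move=> Ar AB; apply/setP => W; rewrite !inE negb_and negbK.
  case: (eqVneq W A) => [->|] /=; first by rewrite Ar AB.
  by case: (W \in r); rewrite ?andbF.
rewrite !E // 1?eq_sym // !the_elt_set1; apply: eq_card => W; rewrite !inE.
by case: (W \in r); case: (W != U); case: (W != V).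
Qed.

Lemma sign_facets (R : pzRingType) r U V :
    is_flag r -> U \in r -> V \in r -> U != V ->
  (-1) ^+ index V (chain r) * (-1) ^+ index U (chain r) =
  (-1) ^+ (epsilon (r :\ V) (r :\ U)).+1 :> R.
Proof.
move=> fr Ur Vr UV; rewrite epsilon_facets // -exprD -signr_odd -[RHS]signr_odd.
congr (_ ^+ nat_of_bool _).
have : \dim U != \dim V by apply: contra_neq UV; apply: flag_dim_inj fr _ _ Ur Vr.
case: ltngtP => // lt _; first by rewrite (card_between fr Ur Vr lt); lia.
rewrite (card_between fr Vr Ur lt).
suff -> : [set W in r :\ U :\ V | between V U W] =
    [set W in r :\ V :\ U | between U V W] by lia.
by apply/setP => W; rewrite !inE between_sym; case: (W != U); case: (W != V).
Qed.

(** Deleting a member of a sorted chain leaves a sorted chain, hence the faces of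
an increasingly ordered simplex need no reordering and their signs are the ones in
the coboundary formula. *)
Lemma face_orient k (rho : simplex F n k.+1) (i : 'I_k.+2) :
  exists2 sigma : simplex F n k,
    val sigma = val rho :\ vertex (orient rho) i &
    face (orient rho) i = orient sigma.
Proof.
set V := vertex _ _; have /andP[fr /eqP cr] := valP rho.
have VE : V = nth fullv (chain (val rho)) i by rewrite /V /vertex (tnth_nth fullv).
have sz : size (chain (val rho)) = k.+2 by rewrite (eqP (orient_proof rho)).
have Vr : V \in val rho by rewrite -chain_mem VE mem_nth // sz.
have sP : is_simplex k (val rho :\ V).
  rewrite /is_simplex (is_flagS (subD1set _ _) fr) /=.
  by have := cardsD1 V (val rho); rewrite cr Vr add1n => /succn_inj/esym/eqP.
exists (Sub (val rho :\ V) sP); first by rewrite SubK.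
apply: osimplexP => j; rewrite vertex_sub /vertex !(tnth_nth fullv) /=.
by rewrite chainD1 VE nth_rem ?chain_uniq ?sz.
Qed.

Lemma osimplex_orient k (s : osimplex F n k) :
  exists sigma (p : 'S_k.+1), s = perm_osimplex (orient sigma) p.
Proof.
have /andP[us fs] := valP s.
have sP : is_simplex k (underlying s).
  by rewrite /is_simplex fs cardsE (card_uniqP us) size_tuple /=.
pose sigma : simplex F n k := Sub (underlying s) sP.
have : perm_eq (val s) (val (orient sigma)).
  apply: uniq_perm => //; first by case/andP: (valP (orient sigma)).
  by move=> V; rewrite chain_mem inE.
case/tuple_permP => p sE; exists sigma, p; exact/val_inj/val_inj.
Qed.

End Orientation.

(** * Coordinates, adjoints and the matrix entries *)

Section CochainTheory.

Variables (R : realFieldType) (F : finFieldType) (n : nat).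

Section Degree.

Variable k : nat.
Implicit Types (phi psi : cochain R F n k) (sigma tau : simplex F n k).

Lemma cochain_ext phi psi :
  (forall sigma, ev phi (orient sigma) = ev psi (orient sigma)) -> phi = psi.
Proof.
move=> e; apply/val_inj/ffunP => s; have [sigma [p ->]] := osimplex_orient s.
by have := e sigma; rewrite /ev !(skewP _ (subvsP _)) => ->.
Qed.

Lemma ev_sum (I : finType) (a : I -> R) (f : I -> cochain R F n k) s :
  ev (\sum_i a i *: f i) s = \sum_i a i * ev (f i) s.
Proof.
rewrite /ev linear_sum /= sum_ffunE; apply: eq_bigr => i _.
by rewrite ffunE.
Qed.

Lemma ev_indicator sigma tau :
  ev (indicator R sigma) (orient tau) = (sigma == tau)%:R.
Proof.
case: eqVneq => [->|ne]; first exact: ev_indicator_orient.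
apply: ev_indicator_neq; rewrite underlying_orient.
by rewrite (inj_eq val_inj) eq_sym.
Qed.

Lemma cochain_indicator phi :
  phi = \sum_sigma ev phi (orient sigma) *: indicator R sigma.
Proof.
apply: cochain_ext => tau; rewrite ev_sum (bigD1 tau) //= ev_indicator eqxx mulr1.
rewrite big1 ?addr0 // => sigma ne.
by rewrite ev_indicator (negPf ne) mulr0.
Qed.

Lemma std_basis_nth (i : 'I_#|{: simplex F n k}|) :
  (std_basis R F n k)`_i = indicator R (enum_val i).
Proof. by rewrite -tnth_nth tnth_mktuple. Qed.

Lemma std_basis_expand phi :
  phi = \sum_(i < #|{: simplex F n k}|)
    ev phi (orient (enum_val i)) *: (std_basis R F n k)`_i.
Proof.
rewrite {1}(cochain_indicator phi) (reindex _ (onW_bij _ (@enum_val_bij _))) /=.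
by apply: eq_bigr => i _; rewrite std_basis_nth.
Qed.

Lemma std_basis_free : free (std_basis R F n k).
Proof.
apply/freeP => a a0 i.
have : ev (\sum_i a i *: (std_basis R F n k)`_i) (orient (enum_val i)) = 0.
  by rewrite a0 /ev linear0 ffunE.
rewrite ev_sum (bigD1 i) //= std_basis_nth ev_indicator eqxx mulr1 big1 ?addr0 //.
move=> j ji; rewrite std_basis_nth ev_indicator.
by rewrite (inj_eq enum_val_inj) (negPf ji) mulr0.
Qed.

Lemma coord_std_basis phi sigma :
  coord (std_basis R F n k) (enum_rank sigma) phi = ev phi (orient sigma).
Proof.
by rewrite {1}(std_basis_expand phi) coord_sum_free ?std_basis_free // enum_rankK.
Qed.

Lemma inner_sumr (I : finType) (a : I -> R) (f : I -> cochain R F n k) phi :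
  inner phi (\sum_i a i *: f i) = \sum_i a i * inner phi (f i).
Proof.
rewrite /inner; under eq_bigr do rewrite ev_sum mulr_sumr.
rewrite exchange_big; apply: eq_bigr => i _; rewrite mulr_sumr.
by apply: eq_bigr => sigma _; rewrite mulrCA.
Qed.

Lemma innerC phi psi : inner phi psi = inner psi phi.
Proof. by apply: eq_bigr => sigma _; rewrite mulrAC. Qed.

Lemma inner_indicator sigma psi :
  inner (indicator R sigma) psi = (weight (val sigma))%:R * ev psi (orient sigma).
Proof.
rewrite /inner (bigD1 sigma) //= ev_indicator eqxx mulr1 big1 ?addr0 // => tau ne.
by rewrite ev_indicator eq_sym (negPf ne) mulr0 mul0r.
Qed.

Lemma weight_neq0 sigma : (weight (val sigma))%:R != 0 :> R.
Proof.
by have /andP[/weight_gt0 w0 _] := valP sigma; rewrite pnatr_eq0 -lt0n.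
Qed.

End Degree.

Section Adjoint.

Variables (k l : nat) (f : 'Hom(cochain R F n k, cochain R F n l)).

(** The formula is forced: pairing an adjoint with 1_sigma determines its
coordinate at sigma up to the factor w(sigma). *)
Definition adjoint_fun (psi : cochain R F n l) : cochain R F n k :=
  \sum_sigma ((weight (val sigma))%:R^-1 * inner (f (indicator R sigma)) psi)
    *: indicator R sigma.

Lemma adjoint_fun_linear : linear adjoint_fun.
Proof.
move=> a psi psi'; rewrite /adjoint_fun scaler_sumr -big_split; apply: eq_bigr => sigma _.
rewrite /= scalerA -scalerDl; congr (_ *: _); rewrite mulrCA -mulrDr; congr (_ * _).
rewrite /inner mulr_sumr -big_split; apply: eq_bigr => tau _ /=.
by rewrite /ev linearP /= !ffunE mulrDr mulrCA.
Qed.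

HB.instance Definition _ :=
  GRing.isLinear.Build _ _ _ _ adjoint_fun adjoint_fun_linear.

Lemma is_adjoint_adjoint_fun : is_adjoint f (linfun adjoint_fun).
Proof.
move=> phi psi; rewrite lfunE /= inner_sumr {1}(cochain_indicator phi) linear_sum /=.
under eq_bigr do rewrite linearZ /=.
rewrite innerC inner_sumr; apply: eq_bigr => sigma _.
rewrite [inner phi _]innerC inner_indicator innerC mulrCA.
by rewrite -mulrA mulrCA mulKf ?weight_neq0 // mulrC.
Qed.

(** The adjoint is defined by choice among the maps satisfying the adjunction, so
exhibiting one such map gives its characteristic property. *)
Lemma adjointP : is_adjoint f (adjoint f).
Proof.
apply: classical_sets.xgetPex; exists (linfun adjoint_fun).
exact: is_adjoint_adjoint_fun.
Qed.

End Adjoint.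

Variable k : nat.
Implicit Types (sigma tau : simplex F n k) (rho : simplex F n k.+1).

(** The incidence number [rho : sigma]. *)
Definition incidence rho sigma : R := ev (d R F n k (indicator R sigma)) (orient rho).

(** Multiplying the entry by w(sigma) turns a coordinate into an inner product with
1_sigma, across which the adjoint moves. *)
Lemma laplacian_entry sigma tau :
  (weight (val sigma))%:R *
    upper_laplacian_mx R F n k (enum_rank sigma) (enum_rank tau) =
  \sum_rho (weight (val rho))%:R * incidence rho sigma * incidence rho tau.
Proof.
rewrite mxE std_basis_nth enum_rankK coord_std_basis -inner_indicator.
by rewrite comp_lfunE -adjointP.
Qed.

Lemma incidenceE rho sigma :
  incidence rho sigma =
  \sum_(i < k.+2) (-1) ^+ i * (val sigma == val rho :\ vertex (orient rho) i)%:R.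
Proof.
rewrite /incidence /d lfunE /= {1}/ev ffunE; apply: eq_bigr => i _.
have [tau tauE ->] := face_orient rho i.
by rewrite ev_indicator -tauE (inj_eq val_inj).
Qed.

Lemma incidence_facet rho sigma V : V \in val rho -> val sigma = val rho :\ V ->
  incidence rho sigma = (-1) ^+ index V (chain (val rho)).
Proof.
move=> Vr sE; have sz : size (chain (val rho)) = k.+2 by rewrite (eqP (orient_proof rho)).
have iP : (index V (chain (val rho)) < k.+2)%N by rewrite -sz index_mem chain_mem.
rewrite incidenceE (bigD1 (Ordinal iP)) //= {1}/vertex (tnth_nth fullv) /=.
rewrite nth_index ?chain_mem // sE eqxx mulr1 big1 ?addr0 // => i ne.
case: eqP => [/setP/(_ V)|]; last by rewrite mulr0.
rewrite !inE eqxx Vr andbT /=; case: eqP => // VE _; case/eqP: ne; apply: val_inj.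
by rewrite /= VE /vertex (tnth_nth fullv) /= index_uniq ?chain_uniq ?sz.
Qed.

Lemma incidence_eq0 rho sigma : ~~ (val sigma \subset val rho) ->
  incidence rho sigma = 0.
Proof.
move=> ns; rewrite incidenceE big1 // => i _.
by case: eqP => [sE|]; [rewrite sE subD1set in ns | rewrite mulr0].
Qed.

Lemma facetP rho sigma : val sigma \subset val rho ->
  exists2 V, V \in val rho & val sigma = val rho :\ V.
Proof.
move=> sr; have /andP[_ /eqP cr] := valP rho; have /andP[_ /eqP cs] := valP sigma.
have /cards1P[V E] : #|val rho :\: val sigma| == 1%N.
  by rewrite cardsD (setIidPr sr) cr cs subSnn.
have : V \in val rho :\: val sigma by rewrite E set11.
rewrite inE => /andP[_ Vr]; exists V => //.
by rewrite -E setDDr setDv set0U; apply/esym/setIidPr.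
Qed.

End CochainTheory.

(** * The three kinds of entries *)

Section Entries.

Variables (R : realFieldType) (F : finFieldType) (n k : nat).
Implicit Types (sigma tau : simplex F n k) (rho : simplex F n k.+1).

Lemma sum_weight_cofacet_simplices sigma :
  (\sum_(rho : simplex F n k.+1 | val sigma \subset val rho) weight (val rho) =
   (n.-1 - #|val sigma|) * weight (val sigma))%N.
Proof.
have /andP[fs /eqP cs] := valP sigma; rewrite -sum_weight_cofacets //.
rewrite [RHS](reindex_omap (val : simplex F n k.+1 -> _) insub) /=; last first.
  by move=> r; rewrite cs => /and3P[fr cr _]; rewrite insubT // /is_simplex fr.
apply: eq_bigl => rho; have /andP[fr cr] := valP rho.
by rewrite fr cs cr valK eqxx andbT.
Qed.

Lemma laplacian_diag sigma :
  upper_laplacian_mx R F n k (enum_rank sigma) (enum_rank sigma) =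
  n%:R - k%:R - 2.
Proof.
have /andP[fs /eqP cs] := valP sigma; have := flag_card_le fs.
rewrite cs => kn; apply: (mulfI (weight_neq0 R sigma)); rewrite laplacian_entry.
transitivity (\sum_(rho : simplex F n k.+1 | val sigma \subset val rho)
  (weight (val rho))%:R : R).
  rewrite [RHS]big_mkcond; apply: eq_bigr => rho _; case: ifPn => [/facetP[V Vr sE]|ns].
    by rewrite (incidence_facet R Vr sE) -mulrA -expr2 sqrr_sign mulr1.
  by rewrite incidence_eq0 // mulr0.
have -> : n%:R - k%:R - 2 = (n.-1 - k.+1)%:R :> R.
  by rewrite -addrA -opprD -natrD -natrB; [congr _%:R|]; lia.
by rewrite mulrC -natrM -natr_sum sum_weight_cofacet_simplices cs.
Qed.

Lemma incidence_mul_eq0 rho sigma tau :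
    ~~ (val sigma :|: val tau \subset val rho) ->
  incidence R rho sigma * incidence R rho tau = 0.
Proof.
by rewrite subUset negb_and => /orP[] /incidence_eq0 ->; rewrite ?mul0r ?mulr0.
Qed.

Lemma laplacian_adjacent sigma tau : let s := val sigma in let t := val tau in
    sigma != tau -> #|s :&: t| = k -> is_flag (s :|: t) ->
  upper_laplacian_mx R F n k (enum_rank sigma) (enum_rank tau) =
  (-1) ^+ (epsilon s t).+1
    * ((gbinom F (r_flag (s :|: t) s) (t_flag (s :|: t) s))%:R)^-1.
Proof.
move=> s t st cst fst.
have /andP[_ /eqP cs] := valP sigma; have /andP[_ /eqP ct] := valP tau.
have rP : is_simplex k.+1 (s :|: t).
  by rewrite /is_simplex fst cardsU cst cs ct; apply/eqP; lia.
pose rho : simplex F n k.+1 := Sub (s :|: t) rP.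
have rE : val rho = s :|: t by rewrite SubK.
have [V Vr sE] : exists2 V, V \in val rho & val sigma = val rho :\ V.
  by apply: facetP; rewrite rE subsetUl.
have [U Ur tE] : exists2 U, U \in val rho & val tau = val rho :\ U.
  by apply: facetP; rewrite rE subsetUr.
have UV : U != V by apply: contra_neq st => UV; apply: val_inj; rewrite sE tE UV.
have Vu : V \in s :|: t by rewrite -rE.
have Uu : U \in s :|: t by rewrite -rE.
have sE' : s = (s :|: t) :\ V by rewrite -rE.
have tE' : t = (s :|: t) :\ U by rewrite -rE.
have := weight_facet fst Vu; have := sign_facets R fst Uu Vu UV.
rewrite -sE' -tE' => signE wE; have w0 := weight_neq0 R sigma.
have g0 := w0; rewrite -/s wE natrM mulf_eq0 negb_or in g0.
have {g0} /andP[g0 _] := g0.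
apply: (mulfI w0); rewrite laplacian_entry (bigD1 rho) //= big1.
  rewrite addr0 (incidence_facet R Vr sE) (incidence_facet R Ur tE) rE.
  rewrite -mulrA signE -/s wE natrM [X in _ = X * _]mulrC -!mulrA.
  by congr (_ * _); rewrite mulrCA divff // mulr1.
move=> rho' ne; rewrite -mulrA incidence_mul_eq0 ?mulr0 //.
apply: contra ne => sub; rewrite -val_eqE rE eq_sym eqEcard sub /=.
by have /andP[_ /eqP ->] := valP rho'; have /andP[_ /eqP ->] := rP.
Qed.

(** A (k+1)-simplex containing both sigma and tau would make their union a flag
with at most k + 2 members; as sigma and tau differ, their intersection would then
have exactly k members. *)
Lemma laplacian_far sigma tau :
    sigma != tau ->
    ~~ ((#|val sigma :&: val tau| == k) && is_flag (val sigma :|: val tau)) ->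
  upper_laplacian_mx R F n k (enum_rank sigma) (enum_rank tau) = 0.
Proof.
move=> st far; apply: (mulfI (weight_neq0 R sigma)).
rewrite laplacian_entry mulr0 big1 // => rho _.
rewrite -mulrA incidence_mul_eq0 ?mulr0 //; apply: contra far => sub.
have /andP[fr /eqP cr] := valP rho; rewrite (is_flagS sub fr) andbT.
have /andP[_ /eqP cs] := valP sigma; have /andP[_ /eqP ct] := valP tau.
have := subset_leq_card sub; rewrite cr cardsU cs ct => cU.
have cI : (#|val sigma :&: val tau| < k.+1)%N.
  rewrite -cs; apply/proper_card; rewrite properE subsetIl; apply: contra st.
  rewrite subsetI subxx /= => sub'.
  by rewrite -val_eqE eqEcard sub' cs ct leqnn.
by apply/eqP; lia.
Qed.

End Entries.

Theorem lemma1p1 (R : realType) (F : finFieldType) (n : nat) (hn : (3 <= n)%N)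
    (k : nat) (sigma tau : simplex F n k) :
  let s := val sigma in
  let t := val tau in
  upper_laplacian_mx R F n k (enum_rank sigma) (enum_rank tau) =
  if sigma == tau then n%:R - k%:R - 2
  else if (#|s :&: t| == k) && is_flag (s :|: t) then
    (-1) ^+ (epsilon s t).+1
    * ((gbinom F (r_flag (s :|: t) s) (t_flag (s :|: t) s))%:R)^-1
  else 0.
Proof.
move=> s t; case: eqVneq => [<-|st]; first exact: laplacian_diag.
case: ifPn => [/andP[/eqP cst fst]|far]; first exact: laplacian_adjacent.
exact: laplacian_far.
Qed.
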